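(* Every rank $3$ graph which admits a singular endomorphism is a hull.
   Context: A rank $3$ graph is a finite simple graph $X$ whose automorphism group $\mathrm{Aut}(X)$ is transitive on the vertices and has exactly $3$ orbits on ordered pairs of vertices. A singular endomorphism is an endomorphism of $X$ that is not a bijection. For a set $M$ of transformations of the vertex set $V$ (acting on the right), $\mathrm{Gr}(M)$ is the graph on $V$ in which distinct $v,w$ are adjacent iff no $f\in M$ satisfies $vf=wf$. The hull of $X$ is $\mathrm{Hull}(X)=\mathrm{Gr}(\mathrm{End}(X))$, and $X$ is a hull if $X=\mathrm{Hull}(X)$. *)

(* Defs.v *)
From mathcomp Require Import all_boot all_fingroup.

Set Implicit Arguments.
Unset Strict Implicit.
Unset Printing Implicit Defensive.

Record sgraph (V : finType) := SGraph {
  adj :> rel V;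
  adj_sym : symmetric adj;
  adj_irr : irreflexive adj
}.

Section PairAction.
Variable V : finType.

Definition pair_act (p : V * V) (s : {perm V}) : V * V := (s p.1, s p.2).

Lemma pair_act1 : pair_act^~ 1%g =1 id.
Proof. by case=> x y; rewrite /pair_act /= !perm1. Qed.

Lemma pair_actM p s t : pair_act p (s * t)%g = pair_act (pair_act p s) t.
Proof. by rewrite /pair_act /= !permM. Qed.

Definition pair_action := TotalAction pair_act1 pair_actM.

End PairAction.

Section GraphDefs.
Variable V : finType.
Implicit Types (X : sgraph V) (M : {set {ffun V -> V}}).

Definition graph_aut X : {set {perm V}} :=
  [set s : {perm V} | [forall x, forall y, X (s x) (s y) == X x y]].

Lemma graph_aut_group_set X : group_set (graph_aut X).
Proof.
apply/group_setP; split=> [|s t]; rewrite !inE.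
  by apply/forallP=> x; apply/forallP=> y; rewrite !perm1.
move=> /forallP Hs /forallP Ht; apply/forallP=> x; apply/forallP=> y.
by rewrite !permM (eqP (forallP (Ht _) _)) (eqP (forallP (Hs _) _)).
Qed.

Canonical graph_aut_group X := Group (graph_aut_group_set X).

Definition rank3 X : Prop :=
  [transitive graph_aut X, on [set: V] | 'P] /\
  #|orbit (pair_action V) (graph_aut X) @: [set: V * V]| = 3.

Definition graph_end X : {set {ffun V -> V}} :=
  [set f : {ffun V -> V} | [forall x, forall y, X x y ==> X (f x) (f y)]].

Definition singular (f : {ffun V -> V}) : Prop := ~ bijective f.

Definition Gr_rel M : rel V :=
  fun v w => (v != w) && ~~ [exists f in M, f v == f w].

Lemma Gr_rel_sym M : symmetric (Gr_rel M).
Proof.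
move=> v w; rewrite /Gr_rel eq_sym; congr (_ && ~~ _).
by apply: eq_existsb => f; rewrite [f v == _]eq_sym.
Qed.

Lemma Gr_rel_irr M : irreflexive (Gr_rel M).
Proof. by move=> v; rewrite /Gr_rel eqxx. Qed.

Definition Gr M : sgraph V := SGraph (@Gr_rel_sym M) (@Gr_rel_irr M).

Definition Hull X : sgraph V := Gr (graph_end X).

(* Equality of graphs on the fixed vertex set V is equality of adjacency
   relations, stated extensionally. *)
Definition is_hull X : Prop := X =2 Hull X.

End GraphDefs.

(* Main.v *)
Require Import Defs.
From mathcomp Require Import all_boot all_fingroup.

(** An endomorphism never identifies adjacent vertices, so a singular one
    identifies some non-adjacent pair [(v, w)]. If [X] has an edge, the diagonal,
    the edges and the non-edges already exhaust the three orbits on pairs, so every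
    non-edge is the image of [(v, w)] under an automorphism [s], and is collapsed by
    [s^-1] followed by the endomorphism. If [X] has no edge, constant maps are
    endomorphisms. *)

Lemma graph_autP (V : finType) (X : sgraph V) (s : {perm V}) :
  reflect (forall x y, X (s x) (s y) = X x y) (s \in graph_aut X).
Proof.
rewrite inE; apply: (iffP forallP) => [Hs x y | Hs x].
  by have /forallP/(_ y)/eqP := Hs x.
by apply/forallP=> y; rewrite Hs.
Qed.

Lemma graph_endP (V : finType) (X : sgraph V) (f : {ffun V -> V}) :
  reflect (forall x y, X x y -> X (f x) (f y)) (f \in graph_end X).
Proof.
rewrite inE; apply: (iffP forallP) => [Hf x y | Hf x].
  by have /forallP/(_ y)/implyP := Hf x.
by apply/forallP=> y; apply/implyP; apply: Hf.
Qed.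

Lemma graph_end_precomp_aut (V : finType) (X : sgraph V) (s : {perm V})
    (f : {ffun V -> V}) :
  s \in graph_aut X -> f \in graph_end X ->
  [ffun x => f (s x)] \in graph_end X.
Proof.
move=> /graph_autP Hs /graph_endP Hf; apply/graph_endP=> x y Xxy.
by rewrite !ffunE; apply: Hf; rewrite Hs.
Qed.

(** These two invariants separate the diagonal, the edges and the non-edges. *)
Lemma pair_orbit_invariant (V : finType) (X : sgraph V) (p q : V * V) :
  p \in orbit (pair_action V) (graph_aut X) q ->
  (p.1 == p.2) = (q.1 == q.2) /\ X p.1 p.2 = X q.1 q.2.
Proof.
case/orbitP=> s /graph_autP Hs <- /=.
by rewrite Hs (inj_eq perm_inj).
Qed.

(** Two distinct orbits of non-edges, together with the diagonal orbit of [(c, c)] and the edge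
    orbit of [(c, d)], would make four. *)
Lemma rank3_nonedge_orbit (V : finType) (X : sgraph V) (c d v w a b : V) :
  rank3 X -> X c d -> v != w -> ~~ X v w -> a != b -> ~~ X a b ->
  (a, b) \in orbit (pair_action V) (graph_aut X) (v, w).
Proof.
move=> [_ card3] Xcd vw Xvw ab Xab; apply/negPn/negP=> Nabvw.
set O := orbit (pair_action V) (graph_aut X) in card3 Nabvw.
have cd : c != d by apply: contraTneq Xcd => ->; rewrite adj_irr.
have sep p q : p \notin O q -> O p != O q.
  by apply: contraNneq => <-; apply: orbit_refl.
pose s := [:: O (c, c); O (c, d); O (a, b); O (v, w)].
have s_uniq : uniq s.
  (* Of the six inequalities, the one between [O (a, b)] and [O (v, w)] is [Nabvw]; the invariants
     give the other five. *)
  rewrite /= !inE !negb_or /= -!andbA; apply/and5P; split;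
    rewrite ?andbT; [| | | |apply/andP; split]; apply: sep => //;
    apply/negP=> /pair_orbit_invariant[] /=;
    by rewrite ?eqxx ?(negPf cd) ?(negPf ab) ?(negPf vw)
               ?Xcd ?(negPf Xab) ?(negPf Xvw).
have s_sub : {subset s <= O @: [set: V * V]}.
  by move=> A; rewrite !inE => /or4P[] /eqP->; apply: imset_f; rewrite inE.
have := subset_leq_card (introT subsetP s_sub).
by rewrite card3 (card_uniqP s_uniq).
Qed.

Theorem mainTheorem3 (V : finType) (X : sgraph V) (hX : rank3 X)
  (hsing : exists2 f : {ffun V -> V}, f \in graph_end X & singular f) :
  is_hull X.
Proof.
case: hsing => f endf singf a b; rewrite /= /Gr_rel.
case: (boolP (X a b)) => [Xab | Xab]; apply/esym.
  apply/andP; split; first by apply: contraTneq Xab => ->; rewrite adj_irr.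
  apply/existsP=> -[g /andP[/graph_endP/(_ a b Xab) Xg /eqP gab]].
  by rewrite gab adj_irr in Xg.
have [//|ab /=] := eqVneq a b; apply/negbF/existsP.
(* As [V] is finite, an injective self-map would be bijective. *)
have /injectivePn[v [w vw fvw]] : ~~ injectiveb f.
  by apply/injectiveP=> /injF_bij.
have Xvw : ~~ X v w.
  by apply/negP=> /(graph_endP _ _ _ endf); rewrite fvw adj_irr.
(* The orbit count takes its edge orbit from an actual edge, hence the case split. *)
have [/existsP[c /existsP[d Xcd]] | noedge] :=
    boolP [exists c, exists d, X c d].
  have /orbitP[s sA [<- <-]] :=
    rank3_nonedge_orbit _ _ _ _ _ _ _ _ hX Xcd vw Xvw ab Xab.
  exists [ffun x => f (s^-1%g x)]; rewrite graph_end_precomp_aut ?groupV //=.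
  by rewrite !ffunE !permK fvw.
exists [ffun=> a]; rewrite !ffunE eqxx andbT; apply/graph_endP=> x y Xxy.
by case/existsP: noedge; exists x; apply/existsP; exists y.
Qed.
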